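(* Let $F\in\mathbb{F}_8[X,Y]$ be a nonzero polynomial all of whose monomials lie in $\Delta$, and let $M=\mathrm{lm}(F)\in\Delta$ be its leading monomial with respect to $\prec_w$. Then $\#\Box_{\prec_w}(F)\ge\delta(M)$, and consequently the codeword $\vec{c}=\mathrm{ev}(F+I_8)$ has Hamming weight $w_H(\vec{c})\ge\delta(M)$, where $\delta:\Delta\to\mathbb{N}$ is given by: - $\delta(X^i)$ for $i=0,1,\dots,7$: $22,19,16,13,10,7,4,1$; - $\delta(X^iY)$ for $i=0,1,\dots,6$: $18,15,12,9,6,4,2$; - $\delta(X^iY^2)$ for $i=0,1,\dots,6$: $13,10,7,5,3,2,1$.
   Context: Let $I_8=\langle Y^3+X^3Y+X,\ X^8+X,\ Y^8+Y\rangle\subseteq\mathbb{F}_8[X,Y]$ (Klein quartic). Its variety over $\mathbb{F}_8$ consists of $22$ distinct points $P_1,\dots,P_{22}$. The evaluation map is $\mathrm{ev}:\mathbb{F}_8[X,Y]/I_8\to\mathbb{F}_8^{22}$, $\mathrm{ev}(F+I_8)=(F(P_1),\dots,F(P_{22}))$. The monomial ordering $\prec_w$ is given by: $X^\alpha Y^\beta\prec_w X^\gamma Y^\delta$ if either $2\alpha+3\beta<2\gamma+3\delta$, or $2\alpha+3\beta=2\gamma+3\delta$ and $\beta<\delta$. The footprint $\Delta=\Delta_{\prec_w}(I_8)$ is the set of monomials that are not the leading monomial (with respect to $\prec_w$) of any polynomial in $I_8$; explicitly $$\Delta=\{X^i\mid 0\le i\le 7\}\cup\{X^iY\mid 0\le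 i\le 6\}\cup\{X^iY^2\mid 0\le i\le 6\}.$$ For a polynomial $F$, $\Box_{\prec_w}(F)$ denotes the set of monomials in $\Delta$ that are the leading monomial (with respect to $\prec_w$) of some polynomial in the ideal $\langle F\rangle+I_8$. *)

(* Defs.v *)
From HB Require Import structures.
From mathcomp Require Import all_boot all_order all_algebra.
From mathcomp Require Import finmap.
From mathcomp Require Import boolp classical_sets functions cardinality.
From mathcomp Require Import mpoly.
Set Implicit Arguments.
Unset Strict Implicit.
Unset Printing Implicit Defensive.
Import GRing.Theory.
Local Open Scope classical_set_scope.
Local Open Scope ring_scope.

(* Indices of the two variables X and Y of K[X, Y] = {mpoly K[2]}; for a
   monomial m = X^a Y^b, m iX = a and m iY = b. *)
Notation iX := (ord0 : 'I_2).
Notation iY := (ord_max : 'I_2).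

Definition wdeg (m : 'X_{1..2}) : nat := (2 * m iX + 3 * m iY)%N.

Definition prec_w (m1 m2 : 'X_{1..2}) : bool :=
  (wdeg m1 < wdeg m2)%N || ((wdeg m1 == wdeg m2) && (m1 iY < m2 iY)%N).

(* mlead is the leading monomial for a degree-lexicographic ordering, hence the
   separate notion here; no m satisfies is_lm 0 m. *)
Definition is_lm (K : fieldType) (f : {mpoly K[2]}) (m : 'X_{1..2}) : Prop :=
  m \in msupp f /\ (forall m', m' \in msupp f -> m' != m -> prec_w m' m).

Definition ideal_gen (K : fieldType) (G : seq {mpoly K[2]}) :
    set {mpoly K[2]} :=
  [set f | exists a : 'I_(size G) -> {mpoly K[2]},
             f = \sum_(i < size G) a i * G`_i].

Definition ideal_add (K : fieldType) (I J : set {mpoly K[2]}) :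
    set {mpoly K[2]} :=
  [set f | exists2 g, I g & exists2 h, J h & f = g + h].

Definition klein_gens (K : fieldType) : seq {mpoly K[2]} :=
  [:: 'X_iY ^+ 3 + 'X_iX ^+ 3 * 'X_iY + 'X_iX;
      'X_iX ^+ 8 + 'X_iX;
      'X_iY ^+ 8 + 'X_iY].

Definition klein_ideal (K : fieldType) : set {mpoly K[2]} :=
  ideal_gen (klein_gens K).
Arguments klein_ideal K : clear implicits.

Definition variety (K : fieldType) (I : set {mpoly K[2]}) :
    set {ffun 'I_2 -> K} :=
  [set p | forall f, I f -> f.@[p] = 0].

Definition footprint (K : fieldType) (I : set {mpoly K[2]}) :
    set 'X_{1..2} :=
  [set m | ~ exists2 f, I f & is_lm f m].

Definition box (K : fieldType) (F : {mpoly K[2]}) : set 'X_{1..2} :=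
  [set m | footprint (klein_ideal K) m /\
     exists2 f, ideal_add (ideal_gen [:: F]) (klein_ideal K) f & is_lm f m].

(* The rows list the values at X^i, X^i Y and X^i Y^2; the value 0 taken at
   all other monomials is junk. *)
Definition delta (m : 'X_{1..2}) : nat :=
  (nth 0 (nth [::] [:: [:: 22; 19; 16; 13; 10; 7; 4; 1];
                        [:: 18; 15; 12; 9; 6; 4; 2];
                        [:: 13; 10; 7; 5; 3; 2; 1]] (m iY)) (m iX))%N.

(* Quotients {ideal_quot _} need a boolean predicate carrying an ideal
   structure. *)
Definition klein_pred (K : fieldType) : {pred {mpoly K[2]}} :=
  fun f => `[< klein_ideal K f >].
Arguments klein_pred K : clear implicits.

Lemma klein_origin (K : fieldType) (f : {mpoly K[2]}) :
  klein_ideal K f -> f.@[fun=> 0] = 0.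
Proof.
move=> [a ->]; rewrite rmorph_sum big1 // => i _; rewrite rmorphM /=.
suff -> : ((klein_gens K)`_i).@[fun=> 0] = 0 by rewrite mulr0.
case: i => [[|[|[|[]]]]] //= _.
all: by rewrite !mevalD ?mevalM ?rmorphXn /= !mevalXU ?expr0n ?mulr0 !addr0.
Qed.

Lemma klein_idealr_closed (K : fieldType) : idealr_closed (klein_pred K).
Proof.
split.
- apply/asboolP; exists (fun=> 0).
  by rewrite big1 // => i _; rewrite mul0r.
- apply/negP => /asboolP /klein_origin /eqP.
  by rewrite meval1 oner_eq0.
- move=> c u v /asboolP[a ->] /asboolP[b ->]; apply/asboolP.
  exists (fun i => c * a i + b i).
  rewrite mulr_sumr -big_split /=; apply: eq_bigr => i _.
  by rewrite mulrDl mulrA.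
Qed.

HB.instance Definition _ (K : fieldType) :=
  isIdealr.Build {mpoly K[2]} (klein_pred K) (klein_idealr_closed K).

Definition klein_quot (K : fieldType) : Type := {ideal_quot (klein_pred K)}.
HB.instance Definition _ (K : fieldType) :=
  GRing.ComNzRing.on (klein_quot K).

(* F + I_8 *)
Definition coset (K : fieldType) (F : {mpoly K[2]}) : klein_quot K :=
  (\pi_({ideal_quot (klein_pred K)}) F)%qT.

(* Evaluation of a canonical representative of the class; lemma ev_coset shows
   that any representative gives the same vector. *)
Definition ev (K : fieldType) (n : nat) (P : 'I_n -> {ffun 'I_2 -> K})
    (q : klein_quot K) : 'rV[K]_n :=
  \row_(i < n) (repr (q : {ideal_quot (klein_pred K)})).@[P i].

Lemma ev_coset (K : fieldType) (n : nat) (P : 'I_n -> {ffun 'I_2 -> K})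
    (F : {mpoly K[2]}) :
  (forall i, variety (klein_ideal K) (P i)) ->
  ev P (coset F) = \row_(i < n) F.@[P i].
Proof.
move=> PV; apply/rowP => i; rewrite !mxE; apply/eqP.
rewrite -subr_eq0 -mevalB; apply/eqP/(PV i)/asboolP.
have : repr (coset F : {ideal_quot (klein_pred K)}) - F \in klein_pred K
  by rewrite Quotient.idealrBE reprK.
by [].
Qed.

Definition hamming_weight (K : fieldType) (n : nat) (c : 'rV[K]_n) : nat :=
  #|[set i | c 0 i != 0]%SET|.

(* Main.v *)
Require Import Defs.
From mathcomp Require Import all_boot all_order all_algebra.
From mathcomp Require Import finmap.
From mathcomp Require Import boolp classical_sets functions cardinality.
From mathcomp Require Import mpoly.
From mathcomp Require Import ring zify.
From mathcomp Require finfield.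
Set Implicit Arguments.
Unset Strict Implicit.
Unset Printing Implicit Defensive.
Import GRing.Theory.
Local Open Scope ring_scope.

(** The monomials of F have Y-degree at most 2, so F = a(X) + b(X) Y + c(X) Y^2.
    Let N(F) in K[X] be the norm of F from K[X, Y] / (Y^3 + X^3 Y + X) to K[X].
    Since the curve has 22 points, every x != 0 carries three of them and x = 0
    carries one; diagonalizing multiplication by F in the fibre over x shows that
    (X - x)^r divides N(F), where r is the number of zeros of F over x. As N(F) is
    nonzero, F has at most deg N(F) zeros, and deg N(F) is at most 3i, 3i + 4,
    3i + 9 when lm(F) is X^i, X^i Y, X^i Y^2 (the total pole order of F at the
    two points at infinity). For the last monomials it is better to count the x
    such that F does not vanish on the whole fibre over x; X^3 Y^2 needs an extra
    argument excluding weight 4. Finally the box has at least as many elements as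
    there are nonzeros of F: otherwise some nonzero combination of the multiples
    of F by point indicators, reduced modulo I_8, would avoid all monomials of
    the box. *)

(** * The norm *)

Lemma det_mx33 (R : comPzRingType) (A : 'M[R]_3) :
  let i0 := 0 : 'I_3 in let i1 := 1 : 'I_3 in let i2 := ord_max : 'I_3 in
  \det A = A i0 i0 * (A i1 i1 * A i2 i2 - A i1 i2 * A i2 i1)
         - A i0 i1 * (A i1 i0 * A i2 i2 - A i1 i2 * A i2 i0)
         + A i0 i2 * (A i1 i0 * A i2 i1 - A i1 i1 * A i2 i0).
Proof.
move=> i0 i1 i2; rewrite (expand_det_row _ i0) !big_ord_recl big_ord0 /cofactor.
rewrite !(expand_det_row _ (0 : 'I_2)) !big_ord_recl !big_ord0 /cofactor.
rewrite !det_mx11 !mxE /= !expr0 !expr1.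
(* Indexing the entries by natural numbers identifies the different ordinal terms left by the two
   cofactor expansions, so that [ring] applies. *)
have [g gE] : exists g, forall i j, A i j = g (nat_of_ord i) (nat_of_ord j).
  by exists (fun i j => A (inord i) (inord j)) => i j; rewrite !inord_val.
rewrite !gE /= /bump /= !add0n !addn0 /=.
move: g {gE} => g; ring.
Qed.

(** Powers of X - x for distinct x are coprime, so their product also divides p and has at most its
    degree. *)
Lemma sum_root_mult_lt (K : finFieldType) (p : {poly K}) (r : K -> nat) :
  p != 0 -> (forall x, ('X - x%:P) ^+ r x %| p) -> (\sum_x r x < size p)%N.
Proof.
move=> p0 dvd_p.
suff : \prod_x ('X - x%:P) ^+ r x %| p.
  move=> /(dvdp_leq p0); rewrite size_prod => [|x _]; last first.
    by rewrite expf_neq0 // polyXsubC_eq0.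
  rewrite [X in (X.+1 - _)%N](eq_bigr (fun x => (r x + 1)%N)) => [|x _].
    by apply: leq_trans; rewrite big_split /= sum1_card subSn ?addnK ?leq_addl.
  by rewrite size_exp_XsubC addn1.
elim: (index_enum K) (index_enum_uniq K) => [|x s IHs] /=.
  by rewrite big_nil dvd1p.
move=> /andP[xs /IHs dvd_s]; rewrite big_cons Gauss_dvdp ?dvd_p //.
rewrite coprimep_expl //; elim: s xs {IHs dvd_s} => [|y s IHs].
  by rewrite big_nil coprimep1.
rewrite inE big_cons negb_or => /andP[xy /IHs]; rewrite coprimepMr => ->.
by rewrite andbT coprimep_expr // coprimep_XsubC2 // subr_eq0 eq_sym.
Qed.

(* The matrix of multiplication by [a + b Y + c Y^2] on the basis [1, Y, Y^2] of
   [K[X, Y] / (Y^3 + X^3 Y + X)] over [K[X]]. *)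
Definition klein_mulmx (K : fieldType) (a b c : {poly K}) : 'M[{poly K}]_3 :=
  let e := a - c * 'X^3 in let g := b * 'X^3 + c * 'X in
  \matrix_(i, j) nth 0 (nth [::]
    [:: [:: a; b; c]; [:: - (c * 'X); e; b]; [:: - (b * 'X); - g; e]] i) j.

Definition klein_norm (K : fieldType) (a b c : {poly K}) : {poly K} :=
  \det (klein_mulmx a b c).

Definition klein_eval (K : fieldType) (a b c : {poly K}) (p : K * K) : K :=
  a.[p.1] + b.[p.1] * p.2 + c.[p.1] * p.2 ^+ 2.

Definition on_klein (K : fieldType) (p : K * K) : bool :=
  p.2 ^+ 3 + p.1 ^+ 3 * p.2 + p.1 == 0.

Lemma klein_normE (K : fieldType) (a b c : {poly K}) :
  let e := a - c * 'X^3 in let g := b * 'X^3 + c * 'X in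
  klein_norm a b c = a * e * e + a * b * g + b * c * ('X * e) - b * b * (b * 'X)
     + c * (c * 'X) * g + c * e * (b * 'X).
Proof. by move=> e g; rewrite /klein_norm det_mx33 !mxE /= -/e -/g; ring. Qed.

Lemma klein_norm_expand (K : fieldType) (a b c : {poly K}) :
  klein_norm a b c = a ^+ 3 - 2%:R * a ^+ 2 * c * 'X^3 + a * c ^+ 2 * 'X^6
    + a * b ^+ 2 * 'X^3 + 3%:R * a * b * c * 'X - b * c ^+ 2 * 'X^4
    - b ^+ 3 * 'X + c ^+ 3 * 'X^2.
Proof. rewrite klein_normE; ring. Qed.

(** Sizes are degrees plus one, so a product of three nonzero factors loses 2, which explains
    [n.+2]. *)
Lemma size_mul3Xn (K : fieldType) (p q r : {poly K}) (k np nq nr n : nat) :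
  (size p <= np)%N -> (size q <= nq)%N -> (size r <= nr)%N ->
  (0 < np -> 0 < nq -> 0 < nr -> np + nq + nr + k <= n.+2)%N ->
  (size (p * q * r * 'X^k)%R <= n)%N.
Proof.
have [->|p0] := eqVneq p 0; first by rewrite !mul0r size_poly0.
have [->|q0] := eqVneq q 0; first by rewrite mulr0 !mul0r size_poly0.
have [->|r0] := eqVneq r 0; first by rewrite mulr0 !mul0r size_poly0.
have ? : p * q != 0 by rewrite mulf_neq0.
rewrite size_mulXn ?mulf_neq0 // !size_mul //.
rewrite -!size_poly_gt0 in p0 q0 r0 * => lep leq ler.
move=> /(_ (leq_trans p0 lep) (leq_trans q0 leq) (leq_trans r0 ler)).
by move: (size p) (size q) (size r) p0 q0 r0 lep leq ler => sp sq sr; lia.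
Qed.

(* The implications allow for zero polynomials: a bound 0 on the size of a factor
   kills the corresponding term. *)
Lemma size_klein_norm (K : fieldType) (a b c : {poly K}) (na nb nc d : nat) :
  (size a <= na)%N -> (size b <= nb)%N -> (size c <= nc)%N ->
  (0 < na -> na + na + na <= d + 3)%N ->
  (0 < na -> 0 < nc -> na + na + nc <= d)%N ->
  (0 < na -> 0 < nc -> na + nc + nc + 3 <= d)%N ->
  (0 < na -> 0 < nb -> na + nb + nb <= d)%N ->
  (0 < na -> 0 < nb -> 0 < nc -> na + nb + nc <= d + 2)%N ->
  (0 < nb -> 0 < nc -> nb + nc + nc < d)%N ->
  (0 < nb -> nb + nb + nb <= d + 2)%N ->
  (0 < nc -> nc + nc + nc <= d + 1)%N ->
  (size (klein_norm a b c) <= d.+1)%N.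
Proof.
move=> sza szb szc *.
have -> : klein_norm a b c = a * a * a * 'X^0 - (a * a * c * 'X^3) *+ 2
    + a * c * c * 'X^6 + a * b * b * 'X^3 + (a * b * c * 'X^1) *+ 3
    - b * c * c * 'X^4 - b * b * b * 'X^1 + c * c * c * 'X^2.
  by rewrite klein_norm_expand expr0 expr1; ring.
have szD (p q : {poly K}) : (size p <= d.+1 -> size q <= d.+1 ->
    size (p + q)%R <= d.+1)%N.
  by move=> *; rewrite (leq_trans (size_polyD _ _)) // geq_max; apply/andP.
have szn (p : {poly K}) n : (size p <= d.+1 -> size (p *+ n)%R <= d.+1)%N.
  by move=> szp; elim: n => [|n IHn]; rewrite ?mulr0n ?size_poly0 // mulrS szD.
by do !apply: (szD _ _); rewrite ?size_polyN; do ?apply: (szn _ _);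
   (apply: size_mul3Xn; [eassumption|eassumption|eassumption|lia]).
Qed.

(* Descent on the X-adic valuation: modulo X the norm is a(0)^3, and the curve
   is totally ramified over X = 0. *)
Lemma klein_norm_neq0 (K : fieldType) (a b c : {poly K}) :
  [|| a != 0, b != 0 | c != 0] -> klein_norm a b c != 0.
Proof.
have divX (p q : {poly K}) : p ^+ 3 = 'X * q -> exists r : {poly K}, p = 'X * r.
  move=> E; have : root p 0.
    have : (p ^+ 3).[0] = 0 by rewrite E hornerM hornerX mul0r.
    by rewrite horner_exp => /eqP; rewrite expf_eq0.
  by move=> /factor_theorem[r ->]; exists r; rewrite subr0 mulrC.
have X0 : 'X != 0 :> {poly K} by rewrite polyX_eq0.
have szX (p : {poly K}) : (size p + (p != 0)%R <= size ('X * p)%R)%N.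
  have [->|p0] := eqVneq p 0; first by rewrite size_poly0.
  by rewrite mulrC size_mulX // addn1.
have [n] := ubnP (size a + size b + size c).
elim: n a b c => // n IHn a b c lt_n abc0; apply/eqP => N0.
have := N0; rewrite klein_norm_expand => H.
have [a1 Ea] : exists r : {poly K}, a = 'X * r.
  apply: (divX _ (2%:R * a ^+ 2 * c * 'X^2 - a * c ^+ 2 * 'X^5
    - a * b ^+ 2 * 'X^2 - 3%:R * a * b * c + b * c ^+ 2 * 'X^3
    + b ^+ 3 - c ^+ 3 * 'X)).
  apply/eqP; rewrite -subr_eq0 -H; apply/eqP; ring.
have {}H : 'X^2 * a1 ^+ 3 - 2%:R * 'X^4 * a1 ^+ 2 * c + a1 * c ^+ 2 * 'X^6
    + a1 * b ^+ 2 * 'X^3 + 3%:R * a1 * b * c * 'X - b * c ^+ 2 * 'X^3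
    - b ^+ 3 + c ^+ 3 * 'X = 0.
  by apply: (mulfI X0); rewrite mulr0 -H Ea; ring.
(* After removal of one factor X the only term free of X is - b^3; after the next removal it is
   c^3. *)
have [b1 Eb] : exists r : {poly K}, b = 'X * r.
  apply: (divX _ ('X * a1 ^+ 3 - 2%:R * 'X^3 * a1 ^+ 2 * c
    + a1 * c ^+ 2 * 'X^5 + a1 * b ^+ 2 * 'X^2 + 3%:R * a1 * b * c
    - b * c ^+ 2 * 'X^2 + c ^+ 3)).
  apply/eqP; rewrite eq_sym -subr_eq0 -H; apply/eqP; ring.
have {}H : 'X * a1 ^+ 3 - 2%:R * 'X^3 * a1 ^+ 2 * c + a1 * c ^+ 2 * 'X^5
    + a1 * b1 ^+ 2 * 'X^4 + 3%:R * a1 * b1 * c * 'X - b1 * c ^+ 2 * 'X^3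
    - b1 ^+ 3 * 'X^2 + c ^+ 3 = 0.
  by apply: (mulfI X0); rewrite mulr0 -H Eb; ring.
have [c1 Ec] : exists r : {poly K}, c = 'X * r.
  apply: (divX _ (- (a1 ^+ 3 - 2%:R * 'X^2 * a1 ^+ 2 * c + a1 * c ^+ 2 * 'X^4
    + a1 * b1 ^+ 2 * 'X^3 + 3%:R * a1 * b1 * c - b1 * c ^+ 2 * 'X^2
    - b1 ^+ 3 * 'X))).
  apply/eqP; rewrite -subr_eq0 -H; apply/eqP; ring.
move: abc0; rewrite Ea Eb Ec !mulf_eq0 !negb_or !X0 /= => abc0.
(* The norm is homogeneous of degree 3, so N(a, b, c) = X^3 N(a1, b1, c1), and the total size has
   dropped because one of the polynomials is nonzero. *)
have : klein_norm a1 b1 c1 != 0.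
  apply: IHn => //; move: lt_n (szX a1) (szX b1) (szX c1) abc0.
  by rewrite Ea Eb Ec; do 3 case: (_ == 0) => /=; lia.
apply/negP; rewrite negbK; apply/eqP/(mulfI (expf_neq0 3 X0)).
rewrite mulr0 -N0 !klein_norm_expand Ea Eb Ec; ring.
Qed.

(* V is the Vandermonde matrix of the Y-coordinates of the fibre; its columns
   are eigenvectors of the multiplication matrix at X = x. *)
Lemma klein_norm_dvd (K : fieldType) (a b c : {poly K}) (x : K) (y : 'I_3 -> K) :
  injective y -> (forall j, on_klein (x, y j)) ->
  ('X - x%:P) ^+ #|[pred j | klein_eval a b c (x, y j) == 0]|
    %| klein_norm a b c.
Proof.
move=> y_inj y_on.
pose V : 'M[{poly K}]_3 := Vandermonde 3 (\row_j (y j)%:P).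
pose M := klein_mulmx a b c.
(* [q j] is a factor of column j of M V: at X = x this column is F(x, y_j) times that of V. *)
pose q j : {poly K} := if klein_eval a b c (x, y j) == 0 then 'X - x%:P else 1.
have col_dvd i j : q j %| (M *m V) i j.
  rewrite /q; case: eqP => [f0|_]; last exact: dvd1p.
  rewrite dvdp_XsubCl; apply/rootP.
  have := y_on j; rewrite /on_klein /= => /eqP y_eq.
  have : ((M *m V) i j).[x] = klein_eval a b c (x, y j) * y j ^+ i.
    rewrite !mxE !big_ord_recl big_ord0 !mxE /klein_eval /=.
    (* The rows of Y and Y^2 satisfy the eigenvector equation only modulo the curve equation; u is
       its multiplier, c for Y and b + c y for Y^2. *)
    have E u v w : v = w - u * (y j ^+ 3 + x ^+ 3 * y j + x) -> v = w.
      by rewrite y_eq mulr0 subr0.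
    case: i => [[|[|[|//]]] lti] /=; rewrite !hornerE /=.
    - ring.
    - apply: (E c.[x]); ring.
    - apply: (E (b.[x] + c.[x] * y j)); ring.
  by rewrite f0 mul0r.
have detV : \det V = (\prod_(i < 3) \prod_(j < 3 | (i < j)%N) (y j - y i))%:P.
  rewrite det_Vandermonde rmorph_prod; apply: eq_bigr => i _.
  by rewrite rmorph_prod; apply: eq_bigr => j _; rewrite !mxE rmorphB.
have : \prod_j q j %| \det (M *m V).
  pose W := \matrix_(i, j) ((M *m V) i j %/ q j).
  rewrite (_ : M *m V = W *m diag_mx (\row_j q j)).
    rewrite det_mulmx det_diag; apply: dvdp_mull.
    by under [X in _ %| X]eq_bigr do rewrite mxE.
  apply/matrixP => i j; rewrite mul_mx_diag [RHS]mxE [W i j]mxE.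
  by rewrite [(\row_j q j) 0 j]mxE divpK.
(* det V is a nonzero constant because the y_j are distinct, so it does not affect divisibility. *)
rewrite det_mulmx -/(klein_norm a b c) detV mulrC mul_polyC dvdpZr; last first.
  apply/prodf_neq0 => i _; apply/prodf_neq0 => j ltij.
  by rewrite subr_eq0 inj_eq // -val_eqE neq_ltn ltij orbT.
suff -> : \prod_j q j
    = ('X - x%:P) ^+ #|[pred j | klein_eval a b c (x, y j) == 0]| by [].
by rewrite -big_mkcond /= prodr_const.
Qed.

(** * Hamming weights on the Klein quartic *)

Lemma card_set_prod (S T : finType) (A : pred (S * T)) :
  #|[set p | A p]| = (\sum_x #|[set y | A (x, y)]|)%N.
Proof.
rewrite -sum1_card (eq_bigl A) => [|p]; last by rewrite inE.
rewrite (eq_bigr (fun x => \sum_(y | A (x, y)) 1)%N) => [|x _]; last first.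
  by rewrite -sum1_card; apply: eq_bigl => y; rewrite inE.
by rewrite pair_big_dep /=; apply: eq_bigl => -[].
Qed.

Lemma leq_sum_card (T : finType) (m : nat) (A : {set T}) (F : T -> nat) :
  (forall x, x \in A -> m <= F x)%N -> (m * #|A| <= \sum_x F x)%N.
Proof.
move=> le_F; rewrite (bigID (mem A)) /= mulnC -sum_nat_const.
by apply: leq_trans (leq_addr _ _); apply: leq_sum.
Qed.

Section KleinWeight.

Variables (K : finFieldType) (card_K : #|K| = 8%N).

Definition fiber (x : K) : {set K} := [set y | on_klein (x, y)].

Lemma card_fiber0_le : (#|fiber 0%R| <= 1)%N.
Proof.
rewrite (leq_trans (subset_leq_card (_ : _ \subset [set 0]))) ?cards1 //.
apply/fintype.subsetP => y; rewrite !inE /on_klein /= expr0n mul0r !addr0.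
by rewrite expf_eq0.
Qed.

Lemma card_fiber_le x : (#|fiber x| <= 3)%N.
Proof.
pose p : {poly K} := 'X^3 + ((x ^+ 3) *: 'X + x%:P).
have szp : size p = 4%N.
  rewrite size_polyDl size_polyXn // ltnS.
  apply: leq_trans (size_polyD _ _) _; rewrite geq_max.
  rewrite (leq_trans (size_scale_leq _ _)) ?size_polyX //.
  by rewrite (leq_trans (size_polyC_leq1 _)).
rewrite cardE -ltnS -szp; apply: max_poly_roots (enum_uniq _).
  by rewrite -size_poly_gt0 szp.
apply/allP => y; rewrite mem_enum inE /on_klein /= => /eqP E.
by apply/rootP; rewrite !hornerE.
Qed.

Lemma card_nonzero : #|[pred x : K | x != 0]| = 7%N.
Proof.
have := cardC (pred1 (0 : K)); rewrite card1 card_K add1n => -[<-].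
by apply: eq_card => x; rewrite !inE.
Qed.

Lemma card_klein_le : (#|[set p : K * K | on_klein p]| <= 22)%N.
Proof.
rewrite (card_set_prod (@on_klein K)) (bigD1 0) //=.
rewrite -[22%N]/(1 + 21)%N leq_add ?card_fiber0_le //.
apply: (@leq_trans (\sum_(x : K | x != 0%R) 3)).
  by apply: leq_sum => x _; apply: card_fiber_le.
by rewrite sum_nat_const card_nonzero.
Qed.

Hypothesis card_C : #|[set p : K * K | on_klein p]| = 22%N.

(** The bounds 1 over x = 0 and 3 over the seven other x add up to 22, the number of points, so each
    of them is attained. *)
Lemma card_fiber x : #|fiber x| = if x == 0 then 1%N else 3%N.
Proof.
have : (\sum_x #|fiber x| = \sum_x if x == 0%R :> K then 1 else 3)%N.
  rewrite -(card_set_prod (@on_klein K)) card_C.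
  rewrite (bigD1 0) //= eqxx (eq_bigr (fun=> 3%N)) => [|y /negPf -> //].
  by rewrite sum_nat_const card_nonzero.
have le y : true -> (#|fiber y| <= (if y == 0%R then 1 else 3) ?= iff
    (#|fiber y| == if y == 0%R then 1 else 3))%N.
  move=> _; apply/leqif_eq; case: eqP => [->|_]; first exact: card_fiber0_le.
  exact: card_fiber_le.
move=> /eqP; rewrite (leqif_sum le) => /forallP /(_ x) /eqP; exact.
Qed.

Section Weight.

Variables a b c : {poly K}.
Local Notation f := (klein_eval a b c).

Definition fiber_zeros (x : K) : {set K} :=
  [set y | on_klein (x, y) && (f (x, y) == 0)].
Definition fiber_nonzeros (x : K) : {set K} :=
  [set y | on_klein (x, y) && (f (x, y) != 0)].
Definition klein_weight : nat := #|[set p | on_klein p && (f p != 0)]|.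

Lemma klein_weightE : klein_weight = (\sum_x #|fiber_nonzeros x|)%N.
Proof. exact: (card_set_prod (fun p => on_klein p && (f p != 0))). Qed.

Lemma card_fiberD x :
  (#|fiber_zeros x| + #|fiber_nonzeros x|)%N = if x == 0 then 1%N else 3%N.
Proof.
rewrite -card_fiber -(cardsID [set y | f (x, y) == 0] (fiber x)).
by congr (_ + _)%N; apply: eq_card => y; rewrite !inE // andbC.
Qed.

Lemma weight_norm d : [|| a != 0, b != 0 | c != 0] ->
  (size (klein_norm a b c) <= d.+1)%N -> (22 - d <= klein_weight)%N.
Proof.
move=> /klein_norm_neq0 N0 szN.
suff : (\sum_x #|fiber_zeros x| < size (klein_norm a b c))%N.
  have : (\sum_x #|fiber_zeros x| + klein_weight = 22)%N.
    rewrite klein_weightE -big_split -card_C (card_set_prod (@on_klein K)).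
    by apply: eq_bigr => x _; rewrite /= card_fiberD -card_fiber.
  lia.
(* Over x = 0 lies only the origin, so [klein_norm_dvd] does not apply; F takes the value a(0)
   there, and the norm takes the value a(0)^3 at 0. *)
apply: sum_root_mult_lt => // x; have [->|x0] := eqVneq x 0.
  have := card_fiberD 0; rewrite eqxx => card1.
  have [->|[y]] := set_0Vmem (fiber_zeros 0); first by rewrite cards0 dvd1p.
  rewrite inE /on_klein /klein_eval /= expr0n mul0r !addr0 expf_eq0 /=.
  move=> /andP[/eqP -> /eqP]; rewrite expr0n !mulr0 !addr0 => a0.
  apply: (@dvdp_trans _ ('X - 0%:P)).
    by rewrite -[X in _ %| X]expr1 dvdp_exp2l // -card1 leq_addr.
  rewrite dvdp_XsubCl; apply/rootP; rewrite klein_norm_expand.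
  by rewrite !hornerE a0 /= !expr0n /= !(mulr0, mul0r, addr0, subr0).
have card3 : #|fiber x| = 3%N by rewrite card_fiber (negPf x0).
pose y (j : 'I_3) := enum_val (cast_ord (esym card3) j).
have y_inj : injective y by move=> i j /enum_val_inj /cast_ord_inj.
have y_on j : on_klein (x, y j).
  by have := enum_valP (cast_ord (esym card3) j); rewrite inE.
have := klein_norm_dvd a b c y_inj y_on; congr (is_true (_ ^+ _ %| _)).
rewrite -(fintype.card_image y_inj); apply: eq_card => t; apply/fintype.imageP/idP.
  by move=> [j]; rewrite !inE => fj ->; rewrite y_on.
rewrite !inE => /andP[t_on ft]; have t_fib : t \in fiber x by rewrite inE.
exists (cast_ord card3 (enum_rank_in t_fib t)).
  by rewrite !inE /y cast_ordK enum_rankK_in.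
by rewrite /y cast_ordK enum_rankK_in.
Qed.

(** On a fibre F is the polynomial a(x) + b(x) Y + c(x) Y^2 in Y alone. *)
Lemma fiber_zeros_lt x :
  [|| a.[x] != 0, b.[x] != 0 | c.[x] != 0] ->
  (#|fiber_zeros x| < size (Poly [:: a.[x]; b.[x]; c.[x]]))%N.
Proof.
move=> abc0; rewrite cardE; apply: max_poly_roots (enum_uniq _).
  apply: contraL abc0 => /eqP/polyP E.
  have := (E 0%N, E 1%N, E 2%N); rewrite !coef_Poly !coef0 /= => -[[-> ->] ->].
  by rewrite eqxx.
apply/allP => y; rewrite mem_enum inE => /andP[_ /eqP f0].
by apply/rootP; rewrite horner_Poly /= -[RHS]f0 /klein_eval /=; ring.
Qed.

Lemma fiber_nonzeros_gt0 x : x != 0 ->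
  [|| a.[x] != 0, b.[x] != 0 | c.[x] != 0] -> (0 < #|fiber_nonzeros x|)%N.
Proof.
move=> x0 /fiber_zeros_lt; move: (card_fiberD x); rewrite (negPf x0).
have := size_Poly [:: a.[x]; b.[x]; c.[x]]; rewrite /=; lia.
Qed.

(** With c = 0 the restriction to the fibre has degree 1 in Y, so at most one of the three points is
    a zero. *)
Lemma fiber_nonzeros_gt1 x : x != 0 -> c = 0 -> b.[x] != 0 ->
  (1 < #|fiber_nonzeros x|)%N.
Proof.
move=> x0 c0 b0; have := @fiber_zeros_lt x; rewrite b0 orbT => /(_ isT).
move: (card_fiberD x); rewrite (negPf x0).
rewrite (_ : Poly _ = Poly [:: a.[x]; b.[x]]).
  have := size_Poly [:: a.[x]; b.[x]]; rewrite /=; lia.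
by apply/polyP => -[|[|[|k]]]; rewrite !coef_Poly c0 horner0 /= ?nth_nil.
Qed.

(** At most [size p - 1] of the 7 nonzero elements are roots; hence 8 = 7 + 1. *)
Lemma card_nonroots (p : {poly K}) : p != 0 ->
  (8 <= #|[set x : K | (x != 0%R) && (p.[x] != 0%R)]| + size p)%N.
Proof.
move=> p0; have : (#|[set x | root p x]| < size p)%N.
  rewrite cardE; apply: max_poly_roots (enum_uniq _) => //.
  by apply/allP => x; rewrite mem_enum inE.
set R := [set x | root p x] => ltR; pose S := [set x : K | x != 0].
have cardS : #|S| = 7%N by rewrite -card_nonzero; apply: eq_card => x; rewrite inE.
rewrite (_ : [set x | _] = S :\: R); last first.
  by apply/setP => x; rewrite !inE andbC.
rewrite -[8%N]/(7.+1) -cardS -(cardsID R S).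
rewrite (leq_trans (_ : _ <= (#|R| + #|S :\: R|).+1)%N) //.
  by rewrite ltnS leq_add2r subset_leq_card ?subsetIr.
by rewrite -addSn addnC leq_add2l.
Qed.

Lemma weight_c : c != 0 -> (8 <= klein_weight + size c)%N.
Proof.
move=> /card_nonroots /leq_trans; apply; rewrite leq_add2r klein_weightE.
rewrite -[X in (X <= _)%N]mul1n; apply: leq_sum_card => x; rewrite inE.
by move=> /andP[x0 cx]; apply: fiber_nonzeros_gt0; rewrite ?cx ?orbT.
Qed.

Lemma weight_b : c = 0 -> b != 0 -> (16 <= klein_weight + 2 * size b)%N.
Proof.
move=> c0 /card_nonroots; rewrite -(leq_pmul2l (isT : 0 < 2)%N) mulnDr.
move=> /leq_trans; apply; rewrite leq_add2r.
rewrite klein_weightE; apply: leq_sum_card => x; rewrite inE.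
by move=> /andP[x0 bx]; apply: fiber_nonzeros_gt1.
Qed.

(* A weight of 4 would force every fibre where c does not vanish to contain
   exactly two zeros of F and all other fibres to consist of zeros. Then c
   divides a and b, and by Vieta the monic quadratic F / c = Y^2 + B Y + A
   satisfies A = B^2 + X^3 and A B = - X identically. *)
Lemma weight_special :
  (size a <= 7)%N -> (size b <= 5)%N -> size c = 4%N -> (4 < klein_weight)%N.
Proof.
move=> sza szb szc; rewrite ltnNge klein_weightE; apply/negP => le4.
have c0 : c != 0 by rewrite -size_poly_gt0 szc.
pose A := [set x : K | (x != 0) && (c.[x] != 0)].
have ge4 : (4 <= #|A|)%N.
  by have := card_nonroots c0; rewrite szc -[8%N]/(4 + 4)%N leq_add2r.
have sumA : (\sum_x (x \in A : nat))%N = #|A|.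
  by rewrite -sum1_card [RHS]big_mkcond; apply: eq_bigr => x _; case: (x \in A).
(* Each x in [A] contributes at least one nonzero, and [A] has at least 4 elements; weight at most 4
   forces equality in every fibre. *)
have le_w x : true -> ((x \in A : nat) <= #|fiber_nonzeros x| ?= iff
    ((x \in A : nat) == #|fiber_nonzeros x|))%N.
  move=> _; apply/leqif_eq; case: (boolP (x \in A)) => //.
  by rewrite inE => /andP[x0 cx]; apply: fiber_nonzeros_gt0; rewrite ?cx ?orbT.
have [le_sum eq_sum] := leqif_sum le_w.
rewrite sumA in le_sum eq_sum.
have cardA : #|A| = 4%N.
  by apply/eqP; rewrite eqn_leq ge4 (leq_trans le_sum).
have wE x : #|fiber_nonzeros x| = (x \in A).
  apply/esym/eqP; move: x; apply/forallP; rewrite -eq_sum.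
  by rewrite eqn_leq le_sum (leq_trans le4).
pose R := [set x : K | (x != 0) && (c.[x] == 0)].
have cardR : #|R| = 3%N.
  have := cardsID A [set x : K | x != 0].
  rewrite (_ : _ :&: A = A); last by apply/setP => x; rewrite !inE andbA andbb.
  rewrite (_ : _ :\: A = R); last first.
    by apply/setP => x; rewrite !inE; case: (x == 0) => //=; rewrite andbT negbK.
  rewrite cardA (_ : #|[set x : K | x != 0]| = 7%N) => [[]//|].
  by rewrite -card_nonzero; apply: eq_card => x; rewrite inE.
pose D : {poly K} := \prod_(x <- enum R) ('X - x%:P).
have szD : size D = 4%N by rewrite size_prod_XsubC -cardE cardR.
have D_neq0 : D != 0 by rewrite -size_poly_gt0 szD.
have dvdD (p : {poly K}) : {in R, forall x, root p x} -> {q : {poly K} | p = q * D}.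
  move=> rp; exists (p %/ D); rewrite divpK //; apply: uniq_roots_dvdp.
    by apply/allP => x; rewrite mem_enum; apply: rp.
  by rewrite uniq_rootsE enum_uniq.
have szM (p q : {poly K}) n : p = q * D -> (size p <= n + 3)%N -> (size q <= n)%N.
  move=> ->; have [->|q0] := eqVneq q 0; first by rewrite size_poly0.
  by rewrite size_mul // szD addnS /= leq_add2r.
(* Over the roots of c in [R] all three points are zeros, which a nonzero polynomial of degree at
   most 2 in Y does not allow. *)
have abR x : x \in R -> (a.[x] == 0) && (b.[x] == 0).
  rewrite inE => /andP[x0 cx]; have := @fiber_nonzeros_gt0 x x0.
  rewrite wE inE x0 cx /= orbF -negb_and; case: (_ && _) => // /(_ isT).
  by rewrite ltnn.
have [c1 Ec] := dvdD c (fun x xR => ltac:(by move: xR; rewrite inE => /andP[])).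
have [b1 Eb] := dvdD b (fun x xR => ltac:(by have /andP[] := abR x xR)).
have [a1 Ea] := dvdD a (fun x xR => ltac:(by have /andP[] := abR x xR)).
have szb1 : (size b1 <= 2)%N by apply: szM Eb _.
have sza1 : (size a1 <= 4)%N by apply: szM Ea _.
have /size1_polyC : (size c1 <= 1)%N by apply: szM Ec _; rewrite szc.
move: (c1`_0) => k Ec1; rewrite {}Ec1 in Ec.
have k0 : k != 0 by apply: contra c0 => /eqP k0; rewrite Ec k0 mul0r.
(* Since c = k D, these are the quotients a / c and b / c. *)
pose al : {poly K} := k^-1 *: a1; pose be : {poly K} := k^-1 *: b1.
have szal : (size al <= 4)%N by apply: leq_trans (size_scale_leq _ _) _.
have szbe : (size be <= 2)%N by apply: leq_trans (size_scale_leq _ _) _.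
have fE x y : f (x, y) = k * D.[x] * (al.[x] + be.[x] * y + y ^+ 2).
  by rewrite /klein_eval /= Ea Eb Ec /al /be !hornerE /=; field.
have D_A x : x \in A -> D.[x] != 0.
  rewrite inE Ec !hornerE mulf_eq0 negb_or => /andP[_ /andP[]]. exact.
have D_0 : D.[0] != 0.
  by rewrite -[_ == 0]/(root D 0) /D root_prod_XsubC mem_enum inE eqxx.
(* The cubic of the fibre has no Y^2 term, so its third root is - (y1 + y2) = be(x); its other
   coefficients give the two equations. *)
have vieta x : x \in A -> al.[x] = be.[x] ^+ 2 + x ^+ 3 /\ al.[x] * be.[x] = - x.
  move=> xA; have x0 : x != 0 by move: xA; rewrite inE => /andP[].
  have : (1 < #|fiber_zeros x|)%N.
    by have := card_fiberD x; rewrite (negPf x0) wE xA; lia.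
  move=> /card_gt1P[y1 [y2 []]]; rewrite !inE !fE /on_klein /= !mulf_eq0.
  rewrite (negPf k0) (negPf (D_A x xA)) /=.
  move=> /andP[/eqP C1 /eqP G1] /andP[/eqP C2 /eqP G2] y12.
  have d0 : y1 - y2 != 0 by rewrite subr_eq0.
  have Hbe : be.[x] = - (y1 + y2).
    apply: (mulfI d0); apply/eqP; rewrite -subr_eq0 -[X in _ == X](subrr 0).
    rewrite -{1}G1 -G2; apply/eqP; ring.
  have Hal : al.[x] = y1 * y2.
    by apply/eqP; rewrite -subr_eq0 -G1 Hbe; apply/eqP; ring.
  have Hx3 : x ^+ 3 = - (y1 ^+ 2 + y1 * y2 + y2 ^+ 2).
    apply: (mulfI d0); apply/eqP; rewrite -subr_eq0 -[X in _ == X](subrr 0).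
    rewrite -{1}C1 -C2; apply/eqP; ring.
  rewrite Hbe Hal Hx3; split; first by ring.
  by apply/eqP; rewrite -subr_eq0 -C1 Hx3; apply/eqP; ring.
(* The fibre over 0 has no nonzeros, so F vanishes at the origin. *)
have al0 : al.[0] = 0.
  have : 0 \in fiber_zeros 0.
    have : 0 \in fiber 0 by rewrite inE /on_klein /= !expr0n /= !mul0r !addr0.
    have /eqP := wE 0; rewrite inE eqxx cards_eq0 => /eqP/setP/(_ 0).
    by rewrite !inE => + on0; rewrite on0 /= => /negbFE.
  rewrite inE fE !expr0n mulr0 !addr0 !mulf_eq0 (negPf k0) (negPf D_0) /=.
  by move=> /andP[_ /eqP].
clearbody al be.
have E1 : al = be ^+ 2 + 'X^3.
  apply/eqP; rewrite -subr_eq0; apply/negPn/negP => nz.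
  have : (#|A| < size (al - (be ^+ 2 + 'X^3))%R)%N.
    rewrite cardE; apply: max_poly_roots (enum_uniq _) => //.
    apply/allP => x; rewrite mem_enum => /vieta[E _].
    by apply/rootP; rewrite !hornerE E subrr.
  rewrite cardA ltnNge; apply/negP; rewrite negbK.
  apply: leq_trans (size_polyD _ _) _; rewrite size_polyN geq_max szal /=.
  apply: leq_trans (size_polyD _ _) _; rewrite size_polyXn geq_max andbT.
  by apply: leq_trans (size_polyMleq _ _) _; lia.
(* The difference may have degree 4, one more than for [E1], so a fifth root is required besides the
   four in [A]: the point 0, by [al0]. *)
have E2 : al * be = - 'X.
  apply/eqP; rewrite -subr_eq0; apply/negPn/negP => nz.
  have : (#|0%R |: A| < size (al * be - - 'X)%R)%N.
    rewrite cardE; apply: max_poly_roots (enum_uniq _) => //.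
    apply/allP => x; rewrite mem_enum in_setU1 => /predU1P[->|/vieta[_ E]].
      by apply/rootP; rewrite !hornerE al0 mul0r oppr0 subrr.
    by apply/rootP; rewrite !hornerE E subrr.
  rewrite cardsU1 cardA inE eqxx ltnNge; apply/negP; rewrite negbK.
  rewrite opprK; apply: leq_trans (size_polyD _ _) _.
  rewrite size_polyX geq_max andbT.
  by apply: leq_trans (size_polyMleq _ _) _; lia.
(* Now X divides be and hence X^2 divides al = be^2 + X^3, which contradicts al be = - X. *)
have be0 : be.[0] = 0.
  have := congr1 (horner^~ 0) E1; rewrite /= !hornerE al0 => /esym/eqP.
  by rewrite expr0n addr0 expf_eq0 => /eqP.
have /factor_theorem[q Eq] : root be 0 by apply/rootP.
have X0 : 'X != 0 :> {poly K} by rewrite polyX_eq0.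
have : q * (q ^+ 2 * 'X^2 + 'X^3) = -1.
  by apply: (mulfI X0); rewrite mulrN1 -E2 E1 Eq; ring.
move=> /(congr1 (horner^~ 0)) /= /eqP; rewrite !hornerE !expr0n /=.
by rewrite !(mulr0, addr0) eq_sym oppr_eq0 oner_eq0.
Qed.

(** The size bounds encode the leading monomial: X^k Y lies below X^i iff k <= i - 2, and X^k Y^2
    iff k <= i - 4. The next two lemmas do the same for X^i Y and X^i Y^2. *)
Lemma weight_delta0 i : size a = i.+1 -> (size b <= i.-1)%N ->
  (size c <= i - 3)%N -> (22 - 3 * i <= klein_weight)%N.
Proof.
move=> sza szb szc; apply: weight_norm; first by rewrite -size_poly_gt0 sza.
by apply: (size_klein_norm (eq_leq sza) szb szc); lia.
Qed.

(** The norm settles i <= 4. For i = 5, 6 counting fibres gives 9 - i if c != 0 and 14 - 2 i if c =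
    0, hence 4 and 2. *)
Lemma weight_delta1 i : (size a <= i.+2)%N -> size b = i.+1 ->
  (size c <= i.-1)%N -> (nth 0 [:: 18; 15; 12; 9; 6; 4; 2] i <= klein_weight)%N.
Proof.
move=> sza szb szc; have b0 : b != 0 by rewrite -size_poly_gt0 szb.
have wN : (22 - (3 * i + 4) <= klein_weight)%N.
  apply: weight_norm; first by rewrite b0 orbT.
  by apply: (size_klein_norm sza (eq_leq szb) szc); lia.
have wbc : (minn (9 - i) (14 - 2 * i) <= klein_weight)%N.
  have [c0|/weight_c] := eqVneq c 0; last by lia.
  by have := weight_b c0 b0; lia.
by case: i {sza szb szc} wN wbc => [|[|[|[|[|[|[|i]]]]]]] /=;
  rewrite ?nth_nil; lia.
Qed.

(** The norm settles i <= 2, the fibre count 7 - i settles i = 4, 5, 6, and [weight_special] settles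
    i = 3. *)
Lemma weight_delta2 i : (size a <= i.+4)%N -> (size b <= i.+2)%N ->
  size c = i.+1 -> (nth 0 [:: 13; 10; 7; 5; 3; 2; 1] i <= klein_weight)%N.
Proof.
move=> sza szb szc; have c0 : c != 0 by rewrite -size_poly_gt0 szc.
have wN : (22 - (3 * i + 9) <= klein_weight)%N.
  apply: weight_norm; first by rewrite c0 !orbT.
  by apply: (size_klein_norm sza szb (eq_leq szc)); lia.
have wc := weight_c c0; rewrite szc in wc.
case: i sza szb szc wN wc => [|[|[|[|[|[|[|i]]]]]]] /= sza szb szc;
  rewrite ?nth_nil; try lia.
by move=> _ _; apply: weight_special.
Qed.

End Weight.
End KleinWeight.

(** * Leading monomials, footprint and box *)

Local Open Scope classical_set_scope.
Local Open Scope ring_scope.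

Definition mon (i j : nat) : 'X_{1..2} := [multinom [tuple i; j]].

Lemma mon_iX i j : mon i j iX = i. Proof. by rewrite multinomE (tnth_nth 0%N). Qed.
Lemma mon_iY i j : mon i j iY = j. Proof. by rewrite multinomE (tnth_nth 0%N). Qed.

Lemma mon2P (m m' : 'X_{1..2}) : m iX = m' iX -> m iY = m' iY -> m = m'.
Proof.
move=> eX eY; apply/mnmP => -[[|[|//]] lti].
  by rewrite (_ : Ordinal lti = iX) //; apply: val_inj.
by rewrite (_ : Ordinal lti = iY) //; apply: val_inj.
Qed.

Lemma mon_eta (m : 'X_{1..2}) : mon (m iX) (m iY) = m.
Proof. by apply: mon2P; rewrite ?mon_iX ?mon_iY. Qed.

(* A rank turning prec_w into the order of the natural numbers; it works since
   m iY <= wdeg m. *)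
Definition mrank (m : 'X_{1..2}) : nat := (wdeg m * (wdeg m).+1 + m iY)%N.

Lemma prec_wE m m' : prec_w m m' = (mrank m < mrank m')%N.
Proof.
have le (n : 'X_{1..2}) : (n iY <= wdeg n)%N by rewrite /wdeg; lia.
rewrite /prec_w /mrank; move: (le m) (le m'); case: ltngtP => /= [lt|gt|->]; nia.
Qed.

Lemma mrank_inj : injective mrank.
Proof.
move=> m m' eq_r; have := prec_wE m m'; have := prec_wE m' m.
rewrite eq_r ltnn /prec_w /wdeg => H H'; apply: mon2P; lia.
Qed.

Lemma is_lmP (K : fieldType) (f : {mpoly K[2]}) m :
  is_lm f m <-> m \in msupp f /\ {in msupp f, forall m', mrank m' <= mrank m}%N.
Proof.
split=> -[mf lm]; split=> // m' m'f.
  have [->//|/(lm _ m'f)] := eqVneq m' m; by rewrite prec_wE => /ltnW.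
by rewrite prec_wE ltn_neqAle (inj_eq mrank_inj) => ->; apply: lm.
Qed.

Lemma ex_lm (K : fieldType) (f : {mpoly K[2]}) : f != 0 -> exists m, is_lm f m.
Proof.
move=> f0; suff [m mf lm] : exists2 m, m \in msupp f &
    {in msupp f, forall m', mrank m' <= mrank m}%N by exists m; apply/is_lmP.
have : msupp f != [::] by rewrite msupp_eq0.
elim: (msupp f : seq _) => // m [|m1 s] IHs _.
  by exists m; rewrite ?inE // => m'; rewrite inE => /eqP->.
have [//|n ns le_n] := IHs _; have [lt|le] := ltnP (mrank n) (mrank m).
  exists m => [|m']; rewrite ?inE ?eqxx // => /predU1P[->//|/le_n].
  by move=> /leq_trans; apply; apply: ltnW.
by exists n => [|m']; rewrite inE ?ns ?orbT // => /predU1P[->|/le_n].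
Qed.

Lemma is_lm_XD (K : fieldType) (m : 'X_{1..2}) (r : {mpoly K[2]}) :
  {in msupp r, forall m', mrank m' < mrank m}%N -> is_lm ('X_[m] + r) m.
Proof.
move=> lt_r; have rm : r@_m = 0.
  by apply: memN_msupp_eq0; apply/negP => /lt_r; rewrite ltnn.
apply/is_lmP; split.
  by rewrite mcoeff_msupp mcoeffD mcoeffX eqxx rm addr0 oner_neq0.
move=> m' /msuppD_le; rewrite mem_cat msuppX inE => /predU1P[->//|/lt_r].
exact: ltnW.
Qed.

(** * Reduction modulo an ideal *)

Section Ideals.
Variable K : fieldType.
Implicit Types (G : seq {mpoly K[2]}) (f g h u : {mpoly K[2]}).

Lemma ideal_gen0 G : ideal_gen G 0.
Proof. by exists (fun=> 0); rewrite big1 // => i _; rewrite mul0r. Qed.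

Lemma ideal_genD G f g : ideal_gen G f -> ideal_gen G g -> ideal_gen G (f + g).
Proof.
move=> [a ->] [b ->]; exists (fun i => a i + b i).
by rewrite -big_split; apply: eq_bigr => i _; rewrite mulrDl.
Qed.

Lemma ideal_genM G u f : ideal_gen G f -> ideal_gen G (u * f).
Proof.
move=> [a ->]; exists (fun i => u * a i).
by rewrite mulr_sumr; apply: eq_bigr => i _; rewrite mulrA.
Qed.

Lemma ideal_gen_nth G i : (i < size G)%N -> ideal_gen G G`_i.
Proof.
move=> lti; exists (fun j => (j == Ordinal lti)%:R).
rewrite (bigD1 (Ordinal lti)) //= eqxx mul1r big1 ?addr0 // => j /negPf ->.
by rewrite mul0r.
Qed.

(** Division with remainder, by induction on a bound for the ranks: the top monomial either lies in
    the footprint and moves to g, or is cancelled by a scalar multiple of an ideal element that it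
    leads. *)
Lemma footprint_reduce G f : exists2 g,
  {in msupp g, forall m, footprint (ideal_gen G) m} & ideal_gen G (f - g).
Proof.
suff : forall n f, {in msupp f, forall m, mrank m < n}%N -> exists2 g,
    {in msupp g, forall m, footprint (ideal_gen G) m} & ideal_gen G (f - g).
  move=> /(_ (\max_(m <- msupp f) mrank m).+1 f); apply=> m mf.
  by rewrite ltnS (big_rem m) //= leq_maxl.
elim=> [|n IHn] {}f lt_f.
  exists 0; first by move=> m; rewrite msupp0.
  suff -> : f = 0 by rewrite subr0; apply: ideal_gen0.
  apply/eqP; rewrite -msupp_eq0; case: (msupp f : seq _) lt_f => // m s.
  by move=> /(_ m); rewrite inE eqxx => /(_ isT).
have [[m mf rm]|none] := pselect (exists2 m, m \in msupp f & mrank m = n);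
  last first.
  apply: IHn => m mf; have := lt_f m mf; rewrite ltnS leq_eqVlt.
  by case/predU1P => // rm; case: none; exists m.
(* As [mrank] is injective, m is the only monomial of rank n, and killing its coefficient lowers the
   bound. *)
have lt_m h : {in msupp h, forall m', mrank m' < n.+1}%N -> h@_m = 0 ->
    {in msupp h, forall m', mrank m' < n}%N.
  move=> le_h hm m' m'h; have := le_h m' m'h; rewrite ltnS leq_eqVlt -rm.
  case/predU1P => // /mrank_inj E; move: m'h; rewrite E mcoeff_msupp hm.
  by rewrite eqxx.
have [m_fp|] := pselect (footprint (ideal_gen G) m).
  have [|g g_fp fg] := IHn (f - f@_m *: 'X_[m]).
    apply: lt_m => [m' /msuppB_le|]; last first.
      by rewrite mcoeffB mcoeffZ mcoeffX eqxx mulr1 subrr.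
    rewrite mem_cat => /orP[/lt_f//|/msuppZ_le]; rewrite msuppX inE => /eqP ->.
    exact: lt_f.
  exists (g + f@_m *: 'X_[m]); last by rewrite opprD addrA addrAC.
  move=> m' /msuppD_le; rewrite mem_cat => /orP[/g_fp//|/msuppZ_le].
  by rewrite msuppX inE => /eqP ->.
move=> /contrapT[h Ih /is_lmP[mh le_h]].
have hm : h@_m != 0 by rewrite -mcoeff_msupp.
have [|g g_fp fg] := IHn (f - (f@_m / h@_m) *: h).
  apply: lt_m => [m' /msuppB_le|]; last by rewrite mcoeffB mcoeffZ divfK ?subrr.
  rewrite mem_cat => /orP[/lt_f//|/msuppZ_le /le_h le].
  by rewrite ltnS (leq_trans le) ?rm.
exists g => //; pose kh := (f@_m / h@_m) *: h.
have -> : f - g = f - kh - g + kh by rewrite addrAC subrK.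
by apply: ideal_genD => //; rewrite /kh -mul_mpolyC; apply: ideal_genM.
Qed.

(** The first two generators have leading monomials Y^3 and X^8. Y^3 and X^3 Y both have weight 9,
    and the tie is broken by the exponent of Y. *)
Lemma footprint_klein (m : 'X_{1..2}) :
  footprint (klein_ideal K) m -> (m iX < 8)%N && (m iY < 3)%N.
Proof.
have dvdm i j : (i <= m iX)%N -> (j <= m iY)%N ->
    exists n, m = (mon i j + n)%MM.
  move=> le_i le_j; exists (mon (m iX - i) (m iY - j)).
  by apply: mon2P; rewrite mnmDE ?mon_iX ?mon_iY subnKC.
have XE : 'X_iX = 'X_[mon 1 0] :> {mpoly K[2]}.
  by congr 'X_[_]; apply: mon2P; rewrite mnm1E ?mon_iX ?mon_iY.
have YE : 'X_iY = 'X_[mon 0 1] :> {mpoly K[2]}.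
  by congr 'X_[_]; apply: mon2P; rewrite mnm1E ?mon_iX ?mon_iY.
move=> fp; rewrite ltnNge [in X in _ && X]ltnNge -negb_or; apply/negP.
move=> /orP[geX|geY]; apply: fp.
- have [n E] := dvdm 8%N 0%N geX (leq0n _).
  exists ('X_[n] * (klein_gens K)`_1); first exact/ideal_genM/ideal_gen_nth.
  rewrite (_ : _ * _ = 'X_[m] + 'X_[mon 1 0 + n]).
    apply: is_lm_XD => m'; rewrite msuppX inE => /eqP ->; rewrite -prec_wE.
    rewrite /prec_w /wdeg E !mnmDE !mon_iX !mon_iY; lia.
  rewrite /= mulrDr !(mulrC 'X_[n]) E !mpolyXD XE mpolyXn; congr (_ + _).
  by congr ('X_[_] * _); apply: mon2P; rewrite mulmnE ?mon_iX ?mon_iY.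
- have [n E] := dvdm 0%N 3%N (leq0n _) geY.
  exists ('X_[n] * (klein_gens K)`_0); first exact/ideal_genM/ideal_gen_nth.
  rewrite (_ : _ * _ = 'X_[m] + ('X_[mon 3 1 + n] + 'X_[mon 1 0 + n])).
    apply: is_lm_XD => m' /msuppD_le; rewrite mem_cat !msuppX !inE.
    by move=> /orP[]/eqP ->; rewrite -prec_wE /prec_w /wdeg;
      rewrite E !mnmDE !mon_iX !mon_iY; lia.
  rewrite /= !mulrDr !(mulrC 'X_[n]) E !mpolyXD XE YE !mpolyXn addrA.
  congr (_ * _ + _ * _ + _); last rewrite -mpolyXD; congr 'X_[_].
    by apply: mon2P; rewrite mulmnE ?mon_iX ?mon_iY.
  by apply: mon2P; rewrite mnmDE mulmnE ?mon_iX ?mon_iY.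
Qed.

End Ideals.

(** The indicator polynomial of the point p: in a field with q elements, 1 - t^(q-1) is 1 at t = 0
    and 0 elsewhere. *)
Definition interp (K : finFieldType) (p : {ffun 'I_2 -> K}) : {mpoly K[2]} :=
  \prod_i (1 - ('X_i - (p i)%:MP) ^+ #|K|.-1).

Lemma interpE (K : finFieldType) (p q : {ffun 'I_2 -> K}) :
  (interp p).@[q] = (p == q)%:R.
Proof.
have K0 : (0 < #|K|.-1)%N by rewrite -subn1 subn_gt0 finfield.finNzRing_gt1.
have indic (t : K) : 1 - t ^+ #|K|.-1 = (t == 0)%:R.
  have [->|t0] := eqVneq; first by rewrite expr0n gtn_eqF // subr0.
  apply/eqP; rewrite subr_eq0 eq_sym; apply/eqP/(mulfI t0).
  by rewrite mulr1 -exprS prednK ?finfield.expf_card // (leq_trans K0) ?leq_pred.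
rewrite rmorph_prod /=.
under eq_bigr do rewrite mevalB meval1 rmorphXn /= mevalB mevalXU mevalC indic.
have [->|neq] := eqVneq p q; first by rewrite big1 // => i _; rewrite subrr eqxx.
have [i npq] : exists i, p i != q i.
  apply/existsP; apply: contraNT neq => /existsPn pq; apply/eqP/ffunP => i.
  by apply/eqP; have := pq i; rewrite negbK.
by rewrite (bigD1 i) //= subr_eq0 eq_sym (negPf npq) mul0r.
Qed.

(** Ensures that [fset_set (box F)] really has the elements of the box. *)
Lemma finite_box (K : fieldType) (F : {mpoly K[2]}) : finite_set (box F).
Proof.
apply: (sub_finite_set (B := (fun p : 'I_8 * 'I_3 => mon p.1 p.2) @` setT)).
  move=> m [/footprint_klein /andP[ltX ltY] _].
  by exists (Ordinal ltX, Ordinal ltY); rewrite //= mon_eta.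
exact/finite_image/finite_finset.
Qed.

(* If the box had fewer elements than there are nonzeros of F on V(I), some
   nontrivial combination of the reduced interpolation multiples of F would have
   no monomial in the box, although its leading monomial lies there. *)
Lemma card_nonzeros_le_box (K : finFieldType) (n : nat)
    (P : 'I_n -> {ffun 'I_2 -> K}) (F : {mpoly K[2]}) :
  injective P -> (forall i, variety (klein_ideal K) (P i)) ->
  (#|[set i | F.@[P i] != 0%R]%SET| <= #|` fset_set (box F)|%fset)%N.
Proof.
move=> P_inj PV; set T := [set i | _]%SET; set B := fset_set _.
rewrite leqNgt; apply/negP => ltBT.
have nzT i : i \in T -> F.@[P i] != 0 by rewrite inE.
clearbody T.
have red i : {g : {mpoly K[2]} |
    {in msupp g, forall m, footprint (klein_ideal K) m} &
    klein_ideal K (interp (P i) * F - g)}.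
  by apply: cid2; apply: footprint_reduce.
pose r i := s2val (red i).
have r_fp i : {in msupp (r i), forall m, footprint (klein_ideal K) m}.
  exact: s2valP (red i).
have r_I i : klein_ideal K (interp (P i) * F - r i) by exact: s2valP' (red i).
have rP i j : (r i).@[P j] = (i == j)%:R * F.@[P j].
  have /eqP := PV j _ (r_I i).
  by rewrite mevalB mevalM interpE (inj_eq P_inj) subr_eq0 => /eqP.
(* Coefficients of the reduced multiples at the monomials of the box; with more rows than columns,
   some nonzero u satisfies u A = 0. *)
pose A : 'M[K]_(#|T|, #|` B|) :=
  \matrix_(i, j) (r (enum_val i))@_(nth 0%MM B j).
have /rowV0Pn[u /sub_kermxP uA u0] : kermx A != 0.
  rewrite kermx_eq0 /row_free neq_ltn.
  by rewrite (leq_ltn_trans (rank_leq_col A) ltBT).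
pose g : {mpoly K[2]} := \sum_i u 0 i *: r (enum_val i).
have gP j : g.@[P (enum_val j)] = u 0 j * F.@[P (enum_val j)].
  have -> x : g.@[x] = \sum_i u 0 i * (r (enum_val i)).@[x].
    by rewrite /g raddf_sum; apply: eq_bigr => i _; apply: mevalZ.
  rewrite (bigD1 j) //= rP eqxx mul1r big1 ?addr0 // => i ij.
  by rewrite rP (inj_eq enum_val_inj) (negPf ij) mul0r mulr0.
(* At the point with index j, g takes the value u_j F(P_j), and F is nonzero there. *)
have g0 : g != 0.
  have [j uj] : exists j, u 0 j != 0.
    apply/existsP; apply: contraNT u0 => /existsPn u0.
    by apply/eqP/rowP => j; rewrite mxE; apply/eqP; have := u0 j; rewrite negbK.
  apply/eqP => gE; have := gP j; rewrite gE meval0 => /esym/eqP.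
  rewrite mulf_eq0 (negPf uj); apply/negP.
  by apply: nzT; apply: enum_valP.
have [m lm_g] := ex_lm g0.
have [mg _] := lm_g.
have mB : m \in B.
  rewrite in_fset_set; last exact: finite_box.
  rewrite inE; split.
    by have /flattenP[s /mapP[i _ ->]] := msupp_sum_le mg; move=> /msuppZ_le /r_fp.
  exists g => //.
  pose h (i : 'I_#|T|) := interp (P (enum_val i)) * F - r (enum_val i).
  exists ((\sum_i u 0 i *: interp (P (enum_val i))) * F).
    exact/ideal_genM/(@ideal_gen_nth _ [:: F] 0).
  exists (- \sum_i u 0 i *: h i); last first.
    rewrite mulr_suml -sumrN -big_split; apply: eq_bigr => i _ /=.
    by rewrite /h scalerBr -scalerAl opprB addrC subrK.
  rewrite -mulN1r; apply: ideal_genM.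
  elim/big_ind: _ => [||i _]; first exact: ideal_gen0.
    exact: ideal_genD.
  by rewrite -mul_mpolyC; apply/ideal_genM/r_I.
(* The coefficient of g at its leading monomial m is an entry of u A, hence 0. *)
have ltm : (index m B < #|` B|)%N by rewrite index_mem.
have := congr1 (fun v : 'rV_ _ => v 0 (Ordinal ltm)) uA; rewrite !mxE => g_m.
move: mg; rewrite mcoeff_msupp => /negP; apply; apply/eqP; rewrite -[RHS]g_m.
rewrite raddf_sum; apply: eq_bigr => i _.
by rewrite /= mcoeffZ !mxE nth_index.
Qed.

(** * F as a polynomial in Y with coefficients in K[X] *)

Section Columns.
Variables (K : fieldType) (F : {mpoly K[2]}).
Hypothesis F_supp :
  forall m : 'X_{1..2}, m \in msupp F -> footprint (klein_ideal K) m.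

Definition column (j : nat) : {poly K} := \poly_(i < 8) F@_(mon i j).

Lemma mcoeff_range (m : 'X_{1..2}) : F@_m != 0 -> (m iX < 8)%N && (m iY < 3)%N.
Proof. by rewrite -mcoeff_msupp => /F_supp /footprint_klein. Qed.

Lemma coef_column j i : (column j)`_i = F@_(mon i j).
Proof.
rewrite coef_poly; case: ltnP => // le8i.
apply/eqP; rewrite eq_sym; apply: contraTT le8i => /mcoeff_range.
by rewrite mon_iX -ltnNge => /andP[].
Qed.

Lemma meval_columns (p : 'I_2 -> K) :
  F.@[p] = klein_eval (column 0) (column 1) (column 2) (p iX, p iY).
Proof.
have -> : F = \sum_(j < 3) \sum_(i < 8) F@_(mon i j) *: 'X_[mon i j].
  apply/mpolyP => m; rewrite raddf_sum /=.
  under eq_bigr do rewrite raddf_sum /=.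
  under eq_bigr do under eq_bigr do rewrite mcoeffZ mcoeffX.
  have [Fm|/mcoeff_range /andP[ltX ltY]] := eqVneq F@_m 0.
    rewrite Fm big1 // => j _; rewrite big1 // => i _.
    by case: eqP => [->|_]; rewrite ?Fm ?mul0r ?mulr0.
  rewrite (bigD1 (Ordinal ltY)) //= (bigD1 (Ordinal ltX)) //= mon_eta eqxx mulr1.
  rewrite !big1 ?addr0 // => [j jY|i iX]; [rewrite big1 // => i _|];
    case: eqP => [E|_]; rewrite ?mulr0 //.
    by case/eqP: jY; apply: val_inj; rewrite /= -E mon_iY.
  by case/eqP: iX; apply: val_inj; rewrite /= -E mon_iX.
have monE i j : 'X_[mon i j].@[p] = p iX ^+ i * p iY ^+ j.
  rewrite mevalX !big_ord_recl big_ord0 mulr1.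
  by rewrite (_ : lift _ _ = iY) ?mon_iX ?mon_iY //; apply: val_inj.
have columnE j : (\sum_(i < 8) F@_(mon i j) *: 'X_[mon i j]).@[p]
    = (column j).[p iX] * p iY ^+ j.
  rewrite raddf_sum horner_poly mulr_suml; apply: eq_bigr => i _.
  by rewrite /= mevalZ monE mulrA.
rewrite raddf_sum /=; under eq_bigr do rewrite columnE.
by rewrite !big_ord_recl big_ord0 addr0 mulr1 addrA.
Qed.

Lemma size_column_le (M : 'X_{1..2}) j n : is_lm F M ->
  (forall i, (n <= i)%N -> (mrank M < mrank (mon i j))%N) ->
  (size (column j) <= n)%N.
Proof.
move=> /is_lmP[_ le_M] lt_M; apply/leq_sizeP => i /lt_M; rewrite coef_column.
rewrite ltnNge => /negP gtM; apply: memN_msupp_eq0; apply/negP => /le_M; exact.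
Qed.

Lemma size_column_eq (M : 'X_{1..2}) : is_lm F M -> size (column (M iY)) = (M iX).+1.
Proof.
move=> lm; apply/anti_leq/andP; split.
  apply: size_column_le lm _ => i lt_i.
  by rewrite -prec_wE /prec_w /wdeg mon_iX mon_iY; lia.
rewrite ltnNge; apply/negP => /leq_sizeP/(_ _ (leqnn _)).
rewrite coef_column mon_eta.
by case: lm; rewrite mcoeff_msupp => /eqP.
Qed.

End Columns.

(* fset_set A is the finite set with the same elements as A, and is empty when
   A is infinite. *)
Theorem mainTheorem2 (K : finFieldType) (card_K : #|K| = 8%N)
  (P : 'I_22 -> {ffun 'I_2 -> K})
  (P_inj : injective P) (P_variety : range P = variety (klein_ideal K))
  (F : {mpoly K[2]}) (F_neq0 : F != 0)
  (F_supp : forall m : 'X_{1..2},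
     m \in msupp F -> footprint (klein_ideal K) m)
  (M : 'X_{1..2}) (lm_F : is_lm F M) :
  (delta M <= #|` fset_set (box F)|%fset)%N /\
  (delta M <= hamming_weight (ev P (coset F)))%N.
Proof.
have PV i : variety (klein_ideal K) (P i) by rewrite -P_variety; exists i.
have -> : hamming_weight (ev P (coset F)) = #|[set i | F.@[P i] != 0]%SET|.
  by rewrite /hamming_weight ev_coset //; apply: eq_card => i; rewrite !inE mxE.
suff ge_delta : (delta M <= #|[set i | F.@[P i] != 0%R]%SET|)%N.
  by split=> //; apply: leq_trans ge_delta (card_nonzeros_le_box _ P_inj PV).
pose pt i : K * K := (P i iX, P i iY).
have pt_inj : injective pt.
  move=> i j [eX eY]; apply: P_inj; apply/ffunP => -[[|[|//]] lti].
    by rewrite (_ : Ordinal lti = iX) //; apply: val_inj.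
  by rewrite (_ : Ordinal lti = iY) //; apply: val_inj.
have pt_on i : on_klein (pt i).
  have /(PV i) : klein_ideal K (klein_gens K)`_0 by apply: ideal_gen_nth.
  by rewrite /= !mevalD !mevalM !mevalXU => /eqP.
have sub : pt @: [set: 'I_22]%SET \subset [set p | on_klein p]%SET.
  by apply/fintype.subsetP => _ /imsetP[i _ ->]; rewrite inE.
have card_pt : #|pt @: [set: 'I_22]%SET| = 22%N.
  by rewrite card_imset // cardsT card_ord.
(* The 22 distinct common zeros lie on the curve, which has at most 22 points over K, so they are
   all of its points. *)
have card_C : #|[set p : K * K | on_klein p]%SET| = 22%N.
  by apply/eqP; rewrite eqn_leq card_klein_le //= -{1}card_pt subset_leq_card.
have /eqP ptT : pt @: [set: 'I_22]%SET == [set p | on_klein p]%SET.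
  by rewrite eqEcard sub card_C card_pt.
pose a := column F 0; pose b := column F 1; pose c := column F 2.
have -> : #|[set i | F.@[P i] != 0]%SET| = klein_weight a b c.
  rewrite /klein_weight -(card_imset _ pt_inj); apply: eq_card => p.
  rewrite inE; apply/imsetP/andP => [[i]|[p_on fp]].
    by rewrite inE meval_columns // => fi ->.
  have : p \in pt @: [set: 'I_22]%SET by rewrite ptT inE.
  by case/imsetP => i _ Ep; exists i; rewrite // inE meval_columns // -/(pt i) -Ep.
have szM := size_column_eq F_supp lm_F.
have sz j n := @size_column_le K F F_supp M j n lm_F.
have rk i j : (mrank M < mrank (mon i j))%N = prec_w M (mon i j) by rewrite prec_wE.
(* One case for each row of the table; beyond the table [delta] is 0. *)
rewrite /delta; case EY : (M iY) szM => [|[|[|j]]] szM /=; last by rewrite !nth_nil.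
- have : (22 - 3 * M iX <= klein_weight a b c)%N.
    apply: weight_delta0 => //; apply: sz => i lt_i;
      by rewrite rk /prec_w /wdeg mon_iX mon_iY EY; lia.
  by case: (M iX) => [|[|[|[|[|[|[|[|i]]]]]]]] //=; rewrite ?nth_nil.
- apply: weight_delta1 => //; apply: sz => i lt_i;
    by rewrite rk /prec_w /wdeg mon_iX mon_iY EY; lia.
- apply: weight_delta2 => //; apply: sz => i lt_i;
    by rewrite rk /prec_w /wdeg mon_iX mon_iY EY; lia.
Qed.
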